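(* Let $\sigma\ge1$ and let $k,t\in\mathbb N$ with $1\le t\le k$. There exist a $\sigma$-semi-metric diversity function with multilinear extension $F$ and a matroid $\mathcal M=([2k],\mathcal I)$ of rank $r=k+t-1$ and minimum circuit size $c=2t$, such that the integrality gap of $F$ over the matroid polytope $P_{\mathcal M}$ is $\Omega(\min\{\frac{r}{c-2},\frac{\sigma}{r}\})$.
   Context: A $\sigma$-semi-metric diversity function is $f(S)=\frac12\sum_{i,j\in S}A_{ij}$ with $A$ symmetric, non-negative, zero diagonal and $A_{ik}\le\sigma(A_{ij}+A_{jk})$ for all $i,j,k$; its multilinear extension is $F(x)=\frac12x^TAx$. $P_{\mathcal M}$ is the convex hull of characteristic vectors of independent sets. The integrality gap is $\max_{x\in P_{\mathcal M}}F(x)\,/\max_{x\in P_{\mathcal M}\cap\{0,1\}^{2k}}F(x)$ (with $r/(c-2)=\infty$ when $c=2$). *)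

(* Defs.v *)
From HB Require Import structures.
From mathcomp Require Import all_boot all_order all_algebra.
From mathcomp Require Import classical_sets reals ereal.

Set Implicit Arguments.
Unset Strict Implicit.
Unset Printing Implicit Defensive.

Import Order.TTheory GRing.Theory Num.Theory.

Local Open Scope ring_scope.

Record matroid (T : finType) := Matroid {
  indep : {set {set T}};
  indep_set0 : finset.set0 \in indep;
  indep_subset : forall I J : {set T},
    I \subset J -> J \in indep -> I \in indep;
  indep_augment : forall I J : {set T},
    I \in indep -> J \in indep -> (#|I| < #|J|)%N ->
    exists2 x, x \in J :\: I & x |: I \in indep }.

Section MatroidTheory.
Variables (T : finType) (M : matroid T).

Definition mrank : nat := \max_(I in indep M) #|I|.

Definition circuit (C : {set T}) : bool :=
  minset [pred D : {set T} | D \notin indep M] C.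

(* A relation rather than a function: a free matroid has no circuit. *)
Definition min_circuit_size (c : nat) : Prop :=
  (exists2 C, circuit C & #|C| = c) /\
  (forall C, circuit C -> (c <= #|C|)%N).

End MatroidTheory.

Section Polytope.
Variable R : numDomainType.

Definition conv_hull (V : lmodType R) (A : set V) : set V :=
  [set x | exists (m : nat) (v : 'I_m -> V) (l : 'I_m -> R),
     [/\ forall i, A (v i), forall i, 0 <= l i, \sum_i l i = 1
       & x = \sum_i l i *: v i]]%classic.

Definition char_vec (n : nat) (S : {set 'I_n}) : 'rV[R]_n :=
  \row_i (i \in S)%:R.

Definition matroid_polytope (n : nat) (M : matroid 'I_n) : set 'rV[R]_n :=
  conv_hull [set char_vec I | I in [set I | I \in indep M]]%classic.

Definition zero_one (n : nat) : set 'rV[R]_n :=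
  [set x : 'rV[R]_n | forall i, x ord0 i = 0 \/ x ord0 i = 1]%classic.

End Polytope.

Arguments matroid_polytope R {n} M _.

Section Diversity.
Variables (R : numFieldType) (n : nat).

Definition semi_metric (sigma : R) (A : 'M[R]_n) : Prop :=
  [/\ forall i j, A i j = A j i,
      forall i j, 0 <= A i j,
      forall i, A i i = 0
    & forall i j k, A i k <= sigma * (A i j + A j k)].

Definition diversity (A : 'M[R]_n) (S : {set 'I_n}) : R :=
  2^-1 * \sum_(i in S) \sum_(j in S) A i j.

Definition semi_metric_diversity (sigma : R) (f : {set 'I_n} -> R) : Prop :=
  exists2 A : 'M[R]_n, semi_metric sigma A & forall S, f S = diversity A S.

Definition multilinear_ext (f : {set 'I_n} -> R) (x : 'rV[R]_n) : R :=
  \sum_(S : {set 'I_n})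
    f S * \prod_i (if i \in S then x ord0 i else 1 - x ord0 i).

Lemma multilinear_diversity (sigma : R) (A : 'M[R]_n) (x : 'rV[R]_n) :
  semi_metric sigma A ->
  multilinear_ext (diversity A) x = 2^-1 * (x *m A *m x^T) ord0 ord0.
Proof.
case=> _ _ A0 _; rewrite /multilinear_ext /diversity.
pose w (S : {set 'I_n}) := \prod_i (if i \in S then x ord0 i else 1 - x ord0 i).
have w2 (i j : 'I_n) : i != j ->
    \sum_(S : {set 'I_n} | (i \in S) && (j \in S)) w S = x ord0 i * x ord0 j.
  move=> ij.
  pose G k := if (k == i) || (k == j) then 0 else 1 - x ord0 k.
  have : \prod_k (x ord0 k + G k) = \sum_(S : {set 'I_n})
      \prod_k (if k \in S then x ord0 k else G k) by apply: bigA_distr.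
  have -> : \prod_k (x ord0 k + G k) = x ord0 i * x ord0 j.
    rewrite (bigD1 i) //= (bigD1 j) 1?eq_sym //= big1 ?mulr1.
      by rewrite /G !eqxx orbT !addr0.
    move=> k /andP[/negbTE ki /negbTE kj].
    by rewrite /G ki kj addrC subrK.
  move=> ->.
  rewrite [RHS](bigID [pred S : {set 'I_n} | (i \in S) && (j \in S)]) /=.
  rewrite [X in _ + X]big1 ?addr0; last first.
    move=> S; rewrite negb_and => /orP[] kS.
      by rewrite (bigD1 i) //= (negbTE kS) /G eqxx mul0r.
    by rewrite (bigD1 j) //= (negbTE kS) /G eqxx orbT mul0r.
  apply: eq_bigr => S /andP[iS jS]; apply: eq_bigr => k _.
  case: ifPn => // kS; rewrite /G.
  have /negbTE-> : k != i by apply: contraNneq kS => ->.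
  by have /negbTE-> : k != j by apply: contraNneq kS => ->.
under eq_bigr => S _ do rewrite -mulrA.
rewrite -mulr_sumr; congr (_ * _).
under eq_bigr => S _ do rewrite big_distrl /= big_mkcond /=.
rewrite exchange_big /= mxE; under [RHS]eq_bigr => j _ do
  rewrite !mxE big_distrl /=.
rewrite [RHS]exchange_big /=; apply: eq_bigr => i _.
rewrite -big_mkcond /=.
under eq_bigr => S _ do rewrite big_distrl /= big_mkcond /=.
rewrite exchange_big /=; apply: eq_bigr => j _.
rewrite -big_mkcondr /= -big_distrr /=.
have [<-|ij] := eqVneq i j; first by rewrite A0 mul0r mulr0 mul0r.
by rewrite w2 // mulrCA mulrA.
Qed.

End Diversity.

Section Gap.
Variable R : realType.

Definition is_maximum (A : set R) (m : R) : Prop := A m /\ ubound A m.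

(* The quotient is taken in the extended reals, where a / 0 = +oo for a > 0
   and 0 / 0 = 0: a function vanishing on P has gap 0. *)
Definition integrality_gap (n : nat) (F : 'rV[R]_n -> R) (P : set 'rV[R]_n)
    (g : \bar R) : Prop :=
  exists a b : R,
    [/\ is_maximum [set F x | x in P]%classic a,
        is_maximum [set F x | x in P `&` @zero_one R n]%classic b
      & g = (a%:E / b%:E)%E].

End Gap.

(* Main.v *)
(** Split [2k] into [k] pairs [{i, rev_ord i}], put distance [2 * sigma] inside
    a pair and [1] between pairs, and call a set independent when it contains
    fewer than [t] full pairs.  An integral point earns [2 * sigma] from at most
    [t - 1] pairs, so with [r = k + t - 1] the integral maximum is
    [r (r - 1) / 2 + (2 sigma - 1) (t - 1)], at most [r^2 / 2 + sigma (c - 2)].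
    The fractional point equal to [1] on [t - 1] pairs and [1/2] elsewhere
    earns something from every pair; it is optimal, because replacing both
    coordinates of a pair by their mean cannot decrease [F] and [F] is convex
    in the pair sums.  Its value is at least [sigma r / 2], whence the gap. *)

Require Import Defs.
From HB Require Import structures.
From mathcomp Require Import all_boot all_order all_algebra.
From mathcomp Require Import classical_sets reals ereal.
From mathcomp Require Import ring lra zify.

Set Implicit Arguments.
Unset Strict Implicit.
Unset Printing Implicit Defensive.

Import Order.TTheory GRing.Theory Num.Theory.

Local Open Scope ring_scope.

Lemma card_ord_range (n a b : nat) : (b <= n)%N ->
  #|[set i : 'I_n | (a <= i < b)%N]| = (b - a)%N.
Proof.
move=> bn; rewrite -sum1_card.
under eq_bigl => i do rewrite inE andbC.
rewrite -(big_geq_mkord a n (fun i => i < b)%N (fun=> 1%N)).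
by rewrite -(@big_nat_widen _ _ _ a b n xpredT) // sum_nat_const_nat muln1.
Qed.

(** * The paired matroid *)

Section PairedMatroid.
Variable k : nat.
Implicit Types (S I J : {set 'I_(2 * k)}) (i : 'I_(2 * k)).

Lemma rev_ord_neq i : rev_ord i != i.
Proof. by apply/eqP => /(congr1 val) /=; have := ltn_ord i; lia. Qed.

Definition paired S := S :&: [set i | rev_ord i \in S].

(** Exactly one member of each pair lies below [k], so each full pair counts once. *)
Definition full_pairs S := #|[set i in paired S | (i < k)%N]|.

Lemma mem_paired S i : (i \in paired S) = (i \in S) && (rev_ord i \in S).
Proof. by rewrite !inE. Qed.

Lemma card_paired S : #|paired S| = (2 * full_pairs S)%N.
Proof.
rewrite -(cardsID [set i : 'I_(2 * k) | (i < k)%N]).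
rewrite [RHS]mul2n -addnn.
congr (_ + _)%N; first by apply: eq_card => i; rewrite !inE.
rewrite /full_pairs -[RHS](card_preimset _ (@rev_ord_inj _)).
apply: eq_card => i; rewrite !inE rev_ordK /= [X in _ = X && _]andbC andbC.
by congr (_ && _); have := ltn_ord i; lia.
Qed.

Lemma full_pairsS I J : I \subset J -> (full_pairs I <= full_pairs J)%N.
Proof.
move=> /fintype.subsetP sIJ; apply/subset_leq_card/fintype.subsetP => i.
by rewrite !inE => /andP[/andP[/sIJ-> /sIJ->]].
Qed.

Lemma full_pairs0 : full_pairs finset.set0 = 0%N.
Proof. by apply: eq_card0 => i; rewrite !inE. Qed.

Lemma full_pairs_setU1 x I : (full_pairs (x |: I) <= (full_pairs I).+1)%N.
Proof.
suff : (#|paired (x |: I)| <= #|paired I| + 2)%N by rewrite !card_paired; lia.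
apply: (@leq_trans #|paired I :|: [set x; rev_ord x]|); last first.
  by rewrite (leq_trans (leq_card_setU _ _)) // leq_add2l cards2; case: eqP.
apply/subset_leq_card/fintype.subsetP => i; rewrite !inE.
rewrite (can2_eq (@rev_ordK _) (@rev_ordK _)).
by do 4!case: (_ == _) || case: (_ \in _).
Qed.

Lemma full_pairs_setU1_new x I :
  rev_ord x \notin I -> full_pairs (x |: I) = full_pairs I.
Proof.
move=> xI; suff : paired (x |: I) = paired I by rewrite /full_pairs => ->.
apply/setP => i; rewrite !inE (can2_eq (@rev_ordK _) (@rev_ordK _)).
have [->|ix] := eqVneq i x.
  by rewrite eq_sym (negbTE (rev_ord_neq x)) (negbTE xI) andbF.
by have [->|] := eqVneq i (rev_ord x); rewrite ?(negbTE xI).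
Qed.

Definition touched S := S :|: [set i | rev_ord i \in S].

(** Inclusion-exclusion for [S] and its mirror image; through [card_paired] it converts
    cardinalities into numbers of full pairs. *)
Lemma card_touched S : (#|touched S| + #|paired S| = 2 * #|S|)%N.
Proof.
rewrite cardsUI [RHS]mul2n -addnn; congr (_ + _)%N.
rewrite -[RHS](card_preimset _ (@rev_ord_inj _)).
by apply: eq_card => i; rewrite !inE.
Qed.

Lemma card_le_full_pairs S : (#|S| <= k + full_pairs S)%N.
Proof.
have := card_touched S; rewrite card_paired.
suff : (#|touched S| <= 2 * k)%N by lia.
by rewrite -[X in (_ <= X)%N]card_ord max_card.
Qed.

Variable t : nat.
Hypothesis t_gt0 : (0 < t)%N.

Definition paired_indep := [set S | (full_pairs S < t)%N].

Lemma paired_indep_set0 : finset.set0 \in paired_indep.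
Proof. by rewrite inE full_pairs0. Qed.

Lemma paired_indep_subset I J :
  I \subset J -> J \in paired_indep -> I \in paired_indep.
Proof. by rewrite !inE => /full_pairsS; exact: leq_ltn_trans. Qed.

(** If some element of [J :\: I] has its partner outside [I], adding it completes no pair. Otherwise
    [I] meets every pair that [J] meets, so by [card_touched] the larger set [J] has strictly more
    full pairs than [I], and any element of [J :\: I] completes at most one. *)
Lemma paired_indep_augment I J :
  I \in paired_indep -> J \in paired_indep -> (#|I| < #|J|)%N ->
  exists2 x, x \in J :\: I & x |: I \in paired_indep.
Proof.
rewrite !inE => It Jt ltIJ.
have [/exists_inP[x xJI xI]|] :=
    boolP [exists x in J :\: I, rev_ord x \notin I].
  by exists x => //; rewrite inE full_pairs_setU1_new.
rewrite negb_exists_in => /forall_inP JI.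
have sJI : touched J \subset touched I.
  have sub i : i \in J -> (i \in I) || (rev_ord i \in I).
    move=> iJ; have [//|iI] := boolP (i \in I).
    by have := JI i; rewrite !inE iJ iI negbK => ->.
  apply/fintype.subsetP => i; rewrite !inE => /orP[/sub//|/sub].
  by rewrite rev_ordK orbC.
have leJI := subset_leq_card sJI.
have [x xJI] : exists x, x \in J :\: I.
  apply/finset.set0Pn; rewrite finset.setD_eq0.
  by apply: contraTN ltIJ => /subset_leq_card; rewrite -leqNgt.
exists x => //; rewrite inE (leq_ltn_trans (full_pairs_setU1 x I)) //.
by have := (card_touched I, card_touched J); rewrite !card_paired => -[]; lia.
Qed.

Definition paired_matroid : matroid 'I_(2 * k) :=
  Matroid paired_indep_set0 paired_indep_subset paired_indep_augment.

Hypothesis t_lek : (t <= k)%N.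

(** The indices below [k] represent every pair once; the remaining [t - 1] indices are partners of
    the last of them. *)
Definition paired_basis : {set 'I_(2 * k)} :=
  [set i : 'I_(2 * k) | (i < k + t.-1)%N].

Lemma card_paired_basis : #|paired_basis| = (k + t.-1)%N.
Proof. by rewrite -[RHS]subn0 -(@card_ord_range (2 * k)) //; lia. Qed.

Lemma full_pairs_paired_basis : full_pairs paired_basis = t.-1.
Proof.
(* The lower members of the full pairs are the indices from [k - t.-1] up to [k], excluded. *)
transitivity (k - (k - t.-1))%N; last lia.
rewrite -(@card_ord_range (2 * k)) //; last lia.
by apply: eq_card => i; rewrite !inE /=; have := ltn_ord i; lia.
Qed.

Lemma paired_basis_indep : paired_basis \in paired_indep.
Proof. by rewrite inE full_pairs_paired_basis; lia. Qed.

Lemma mrank_paired_matroid : mrank paired_matroid = (k + t.-1)%N.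
Proof.
apply/eqP; rewrite eqn_leq; apply/andP; split.
  apply/bigmax_leqP => S; rewrite inE => St.
  by have := card_le_full_pairs S; lia.
rewrite -card_paired_basis.
exact: (leq_bigmax_cond paired_basis paired_basis_indep).
Qed.

Lemma min_circuit_size_paired_matroid :
  min_circuit_size paired_matroid (2 * t).
Proof.
have dep_ge S : S \notin paired_indep -> (2 * t <= #|S|)%N.
  rewrite inE -leqNgt => tS; apply: (@leq_trans #|paired S|).
    by rewrite card_paired leq_mul2l.
  exact/subset_leq_card/finset.subsetIl.
split=> [|C /minsetP[/dep_ge]//].
(* An interval centred at the middle is stable under [rev_ord], so this one consists of exactly [t]
   full pairs. *)
pose C : {set 'I_(2 * k)} :=
  [set i : 'I_(2 * k) | (k - t <= i < k + t)%N].
have cardC : #|C| = (2 * t)%N by rewrite card_ord_range; lia.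
exists C => //; apply/minsetP; split=> [|S /dep_ge tS SC].
  rewrite !inE -leqNgt -[X in (X <= _)%N](_ : k - (k - t) = t)%N; last lia.
  rewrite -(@card_ord_range (2 * k)) //; last lia.
  apply/subset_leq_card/fintype.subsetP => i; rewrite !inE /=.
  by have := ltn_ord i; lia.
by apply/eqP; rewrite eqEcard SC cardC tS.
Qed.

End PairedMatroid.

Lemma sum_rev_ord (V : nmodType) (n : nat) (G : 'I_n -> V) :
  \sum_i G (rev_ord i) = \sum_i G i.
Proof. by rewrite [RHS](reindex_inj rev_ord_inj). Qed.

(** * The diversity function *)

Section PairedDiversity.
Variables (R : realType) (k : nat) (sigma : R).
Hypothesis sigma_ge1 : 1 <= sigma.
Implicit Types (x : 'rV[R]_(2 * k)) (i j l : 'I_(2 * k)).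

(** All-ones matrix minus the identity plus a multiple of the permutation matrix of [rev_ord]: the
    quadratic form splits accordingly into [xsum], [xsqr] and [xpair]. *)
Definition paired_mx : 'M[R]_(2 * k) :=
  \matrix_(i, j) (1 - (i == j)%:R + (2 * sigma - 1) * (i == rev_ord j)%:R).

Lemma paired_mx_diag i : paired_mx i i = 0.
Proof.
by rewrite mxE eqxx eq_sym (negbTE (rev_ord_neq i)) mulr0 addr0 subrr.
Qed.

Lemma paired_mx_bounds i j : i != j -> 1 <= paired_mx i j <= 2 * sigma.
Proof.
move=> /negbTE ij; rewrite mxE ij; case: (_ == _) => /=;
by have := sigma_ge1; lra.
Qed.

(** For three distinct indices the left side is at most [2 * sigma] and both distances on the right
    are at least 1; coinciding indices are immediate. *)
Lemma semi_metric_paired_mx : semi_metric sigma paired_mx.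
Proof.
have s1 := sigma_ge1; have A_ge0 i j : 0 <= paired_mx i j.
  have [->|/paired_mx_bounds] := eqVneq i j; rewrite ?paired_mx_diag //; lra.
split=> // [i j||i j l]; last first.
- have [<-|il] := eqVneq i l.
    by rewrite paired_mx_diag; apply: mulr_ge0; [lra|exact: addr_ge0].
  have [<-|ij] := eqVneq i j.
    by rewrite paired_mx_diag add0r ler_peMl.
  have [<-|jl] := eqVneq j l.
    by rewrite paired_mx_diag addr0 ler_peMl.
  have := paired_mx_bounds il; have := paired_mx_bounds ij.
  by have := paired_mx_bounds jl; nra.
- exact: paired_mx_diag.
- rewrite !mxE [j == i]eq_sym -(can2_eq (@rev_ordK _) (@rev_ordK _)).
  by rewrite [rev_ord i == j]eq_sym.
Qed.

Definition xsum x : R := \sum_i x ord0 i.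
Definition xsqr x : R := \sum_i x ord0 i ^+ 2.
Definition xpair x : R := \sum_i x ord0 i * x ord0 (rev_ord i).

Lemma multilinear_paired x :
  multilinear_ext (diversity paired_mx) x =
  2^-1 * (xsum x ^+ 2 - xsqr x + (2 * sigma - 1) * xpair x).
Proof.
rewrite (multilinear_diversity _ semi_metric_paired_mx); congr (_ * _).
rewrite mxE expr2 /xsqr /xpair mulr_sumr mulr_sumr -sumrB -big_split /=.
apply: eq_bigr => j _; rewrite !mxE.
have -> : \sum_i x ord0 i * paired_mx i j =
    xsum x - x ord0 j + (2 * sigma - 1) * x ord0 (rev_ord j).
  under eq_bigr => i _ do rewrite mxE mulrDr mulrBr mulr1.
  rewrite big_split sumrB /=; congr (_ - _ + _).
    rewrite (bigD1 j) //= eqxx mulr1 big1 ?addr0 // => i /negbTE->.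
    by rewrite mulr0.
  under eq_bigr => i _ do rewrite mulrCA.
  rewrite -mulr_sumr; congr (_ * _).
  rewrite (bigD1 (rev_ord j)) //= eqxx mulr1 big1 ?addr0 // => i /negbTE->.
  by rewrite mulr0.
ring.
Qed.

(** This exhibits [xsqr + xpair] as a convex function, which [xpair] alone is not. *)
Lemma sum_pair_sqr x :
  \sum_i (x ord0 i + x ord0 (rev_ord i)) ^+ 2 = 2 * (xsqr x + xpair x).
Proof.
under eq_bigr => i _ do rewrite sqrrD.
rewrite 2!big_split /= (sum_rev_ord (fun i => x ord0 i ^+ 2)).
by rewrite sumrMnl -/(xsqr x) -/(xpair x); ring.
Qed.

Lemma xpair_le_xsqr x : xpair x <= xsqr x.
Proof.
have : 0 <= \sum_i (x ord0 i - x ord0 (rev_ord i)) ^+ 2.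
  by apply: sumr_ge0 => i _; exact: sqr_ge0.
under eq_bigr => i _ do rewrite sqrrB.
rewrite big_split sumrB /= (sum_rev_ord (fun i => x ord0 i ^+ 2)).
by rewrite sumrMnl -/(xsqr x) -/(xpair x); lra.
Qed.

Lemma xsum_char_vec (S : {set 'I_(2 * k)}) : xsum (char_vec R S) = #|S|%:R.
Proof.
rewrite -sum1_card natr_sum [RHS]big_mkcond; apply: eq_bigr => i _.
by rewrite mxE; case: (_ \in _).
Qed.

Lemma xsqr_char_vec (S : {set 'I_(2 * k)}) : xsqr (char_vec R S) = #|S|%:R.
Proof.
rewrite -xsum_char_vec; apply: eq_bigr => i _.
by rewrite !mxE; case: (_ \in _); rewrite ?expr1n ?expr0n.
Qed.

Lemma xpair_char_vec (S : {set 'I_(2 * k)}) :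
  xpair (char_vec R S) = (2 * full_pairs S)%:R.
Proof.
rewrite -card_paired -sum1_card natr_sum [RHS]big_mkcond.
apply: eq_bigr => i _; rewrite !mxE mem_paired.
by do 2!case: (_ \in _); rewrite ?mulr1 ?mulr0.
Qed.

End PairedDiversity.

(** * Convexity and the two maxima over the matroid polytope *)

(** The difference of the two sides is a variance. *)
Lemma conv_sqr_le (R : realFieldType) (m : nat) (l y : 'I_m -> R) :
  (forall i, 0 <= l i) -> \sum_i l i = 1 ->
  (\sum_i l i * y i) ^+ 2 <= \sum_i l i * y i ^+ 2.
Proof.
move=> l0 l1; move zE : (\sum_i l i * y i) => z.
have : 0 <= \sum_i l i * (y i - z) ^+ 2.
  by apply: sumr_ge0 => i _; apply: mulr_ge0; rewrite ?sqr_ge0.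
have -> : \sum_i l i * (y i - z) ^+ 2 =
    \sum_i l i * y i ^+ 2 - 2 * z * (\sum_i l i * y i) + z ^+ 2 * \sum_i l i.
  rewrite !mulr_sumr -sumrB -big_split /=.
  by apply: eq_bigr => i _; ring.
by rewrite l1 zE; lra.
Qed.

Lemma conv_le (R : realFieldType) (m : nat) (l y : 'I_m -> R) (c : R) :
  (forall i, 0 <= l i) -> \sum_i l i = 1 -> (forall i, y i <= c) ->
  \sum_i l i * y i <= c.
Proof.
move=> l0 l1 yc; rewrite -[c]mul1r -l1 mulr_suml.
by apply: ler_sum => i _; apply: ler_wpM2l.
Qed.

Section PairedPolytope.
Variables (R : realType) (k t : nat).
Hypotheses (t_gt0 : (0 < t)%N) (t_lek : (t <= k)%N).
Notation M := (paired_matroid k t_gt0).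
Notation r := ((k + t.-1)%:R : R).
Notation u := (t.-1%:R : R).
Implicit Types x : 'rV[R]_(2 * k).

Lemma indep_char_vec_bounds (S : {set 'I_(2 * k)}) : S \in indep M ->
  xsum (char_vec R S) <= r /\ xpair (char_vec R S) <= 2 * u.
Proof.
rewrite inE => St; rewrite xsum_char_vec xpair_char_vec -natrM !ler_nat.
by have := card_le_full_pairs S; lia.
Qed.

(** [xsum] is linear and [xsqr + xpair] convex, so the bounds pass from characteristic vectors of
    independent sets to their convex combinations. *)
Lemma matroid_polytope_bounds x : matroid_polytope R M x ->
  [/\ 0 <= xsum x, xsum x <= r & xsqr x + xpair x <= r + 2 * u].
Proof.
move=> [m [v [l [vM l0 l1 ->]]]].
have xE i : (\sum_j l j *: v j) ord0 i = \sum_j l j * v j ord0 i.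
  by rewrite summxE; apply: eq_bigr => j _; rewrite mxE.
have sE : xsum (\sum_j l j *: v j) = \sum_j l j * xsum (v j).
  rewrite /xsum; under eq_bigr => i _ do rewrite xE.
  by rewrite exchange_big; apply: eq_bigr => j _; rewrite mulr_sumr.
rewrite sE; split.
- apply: sumr_ge0 => j _; apply: mulr_ge0 => //.
  by have [S _ <-] := vM j; rewrite xsum_char_vec ler0n.
- apply: conv_le => // j.
  by have [S /indep_char_vec_bounds[? _] <-] := vM j.
have -> : forall a b : R, (a <= b) = (2 * a <= 2 * b).
  by move=> a b; rewrite ler_pM2l.
rewrite -sum_pair_sqr.
apply: (@le_trans _ _ (\sum_j l j *
    (\sum_i (v j ord0 i + v j ord0 (rev_ord i)) ^+ 2))).
  under [leRHS]eq_bigr => j _ do rewrite mulr_sumr.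
  rewrite exchange_big /=; apply: ler_sum => i _.
  rewrite !xE -big_split /=; under eq_bigr => j _ do rewrite -mulrDr.
  exact: conv_sqr_le.
apply: conv_le => // j; rewrite sum_pair_sqr ler_pM2l //.
have [S /indep_char_vec_bounds[] + + <-] := vM j.
by rewrite xsqr_char_vec xsum_char_vec; exact: lerD.
Qed.

(** At a 0-1 point a product [a * b] equals the maximum of 0 and [a + b - 1]. Each of these is
    bounded by the average of the products at the vertices [v j], whose [xpair] is at most
    [2 * u]. *)
Lemma matroid_polytope_zero_one_xpair x :
  matroid_polytope R M x -> zero_one x -> xpair x <= 2 * u.
Proof.
move=> [m [v [l [vM l0 l1 xE]]]] x01.
have xiE i : x ord0 i = \sum_j l j * v j ord0 i.
  by rewrite xE summxE; apply: eq_bigr => j _; rewrite mxE.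
have v01 j i : v j ord0 i = 0 \/ v j ord0 i = 1.
  have [S _ <-] := vM j; rewrite mxE.
  by case: (i \in S); [right|left].
apply: (@le_trans _ _ (\sum_j l j * xpair (v j))); last first.
  apply: conv_le => // j.
  by have [S /indep_char_vec_bounds[_ ?] <-] := vM j.
rewrite /xpair; under [leRHS]eq_bigr => j _ do rewrite mulr_sumr.
rewrite exchange_big /=; apply: ler_sum => i _.
have rhs_ge0 : 0 <= \sum_j l j * (v j ord0 i * v j ord0 (rev_ord i)).
  apply: sumr_ge0 => j _; apply: mulr_ge0 => //.
  by case: (v01 j i) (v01 j (rev_ord i)) => -> [] ->; lra.
(* For 0-1 entries [a * b] dominates the affine function [a + b - 1], with
   equality unless [a = b = 0]. *)
have aff_le : x ord0 i + x ord0 (rev_ord i) - 1 <=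
    \sum_j l j * (v j ord0 i * v j ord0 (rev_ord i)).
  rewrite !xiE -l1 -big_split -sumrB /=; apply: ler_sum => j _.
  by case: (v01 j i) (v01 j (rev_ord i)) => -> [] ->; have := l0 j; lra.
by case: (x01 i) (x01 (rev_ord i)) aff_le => -> [] -> ; lra.
Qed.

Lemma char_vec_matroid_polytope (S : {set 'I_(2 * k)}) :
  S \in indep M -> matroid_polytope R M (char_vec R S).
Proof.
move=> SM; exists 1%N, (fun=> char_vec R S), (fun=> 1); split=> //.
- by move=> _; exists S.
- by rewrite big_ord1.
- by rewrite big_ord1 scale1r.
Qed.

Lemma zero_one_char_vec (S : {set 'I_(2 * k)}) : zero_one (char_vec R S).
Proof. by move=> i; rewrite mxE; case: (_ \in _); [right|left]. Qed.

(* The midpoint of the basis and its mirror image: [1] on [t - 1] pairs and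
   [1/2] on the others. *)
Definition frac_point : 'rV[R]_(2 * k) :=
  \row_i (2^-1 * (char_vec R (paired_basis k t) ord0 i +
                  char_vec R (paired_basis k t) ord0 (rev_ord i))).

Lemma frac_point_matroid_polytope : matroid_polytope R M frac_point.
Proof.
(* The mirror image [B'] has as many full pairs as [B], since [rev_ord] maps [paired B'] onto
   [paired B]. *)
pose B := paired_basis k t; pose B' := [set i | rev_ord i \in B].
have B'M : B' \in paired_indep k t.
  have := paired_basis_indep t_gt0 t_lek; rewrite !inE; congr (_ < _)%N.
  apply: double_inj; rewrite -!mul2n -!card_paired.
  rewrite -[LHS](card_preimset _ (@rev_ord_inj _)).
  by apply: eq_card => i; rewrite !inE.
exists 2%N, (fun j => char_vec R (if j == ord0 then B else B')), (fun=> 2^-1).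
split=> [j|j||].
- exists (if j == ord0 then B else B') => //.
  by case: eqP => // _; exact: paired_basis_indep.
- by rewrite invr_ge0.
- by rewrite big_ord_recl big_ord1; lra.
- by apply/rowP => i; rewrite big_ord_recl big_ord1 /= !mxE !inE; ring.
Qed.

Lemma xsum_frac_point : xsum frac_point = r.
Proof.
rewrite /xsum; under eq_bigr => i _ do rewrite mxE.
rewrite -mulr_sumr big_split /=.
rewrite (sum_rev_ord (fun i => char_vec R (paired_basis k t) ord0 i)).
by rewrite -/(xsum _) xsum_char_vec card_paired_basis //; lra.
Qed.

Lemma xpair_frac_point : xpair frac_point = xsqr frac_point.
Proof. by apply: eq_bigr => i _; rewrite !mxE rev_ordK; ring. Qed.

Lemma xsqr_frac_point : xsqr frac_point = 2^-1 * (r + 2 * u).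
Proof.
rewrite /xsqr; under eq_bigr => i _ do rewrite mxE exprMn.
rewrite -mulr_sumr sum_pair_sqr xsqr_char_vec xpair_char_vec.
by rewrite card_paired_basis // full_pairs_paired_basis // natrM; field.
Qed.

Variable sigma : R.
Hypothesis sigma_ge1 : 1 <= sigma.
Notation F := (multilinear_ext (diversity (paired_mx k sigma))).

(* Bounding [xpair x] by [(xsqr x + xpair x) / 2] turns [F] into a convex
   function of the pair sums, so only the vertices of the polytope matter. *)
Lemma is_maximum_frac :
  is_maximum [set F x | x in matroid_polytope R M]%classic
    (2^-1 * (r ^+ 2 + (sigma - 1) * (r + 2 * u))).
Proof.
have s1 := sigma_ge1; split.
  exists frac_point; first exact: frac_point_matroid_polytope.
  rewrite multilinear_paired // xpair_frac_point xsum_frac_point.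
  by rewrite xsqr_frac_point; field.
move=> _ [x xP <-]; rewrite multilinear_paired //.
have [s0 sr qp] := matroid_polytope_bounds xP.
(* [2 * F x] is [xsum x ^+ 2 + (sigma - 1) * (xsqr x + xpair x) - sigma * (xsqr x - xpair x)]; each
   term is bounded separately. *)
have : 0 <= sigma * (xsqr x - xpair x).
  by rewrite mulr_ge0 ?subr_ge0 ?xpair_le_xsqr //; lra.
have : (sigma - 1) * (xsqr x + xpair x) <= (sigma - 1) * (r + 2 * u).
  by rewrite ler_wpM2l //; lra.
have : xsum x ^+ 2 <= r ^+ 2 by rewrite lerXn2r ?nnegrE ?ler0n.
lra.
Qed.

Lemma is_maximum_integral :
  is_maximum [set F x | x in matroid_polytope R M `&` @zero_one R _]%classic
    (2^-1 * (r * (r - 1)) + (2 * sigma - 1) * u).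
Proof.
have s1 := sigma_ge1; split.
  exists (char_vec R (paired_basis k t)).
    split; last exact: zero_one_char_vec.
    exact/char_vec_matroid_polytope/paired_basis_indep.
  rewrite multilinear_paired // xsum_char_vec xsqr_char_vec xpair_char_vec.
  by rewrite card_paired_basis // full_pairs_paired_basis // natrM; field.
move=> _ [x [xP x01] <-]; rewrite multilinear_paired //.
have [s0 sr _] := matroid_polytope_bounds xP.
have p_le := matroid_polytope_zero_one_xpair xP x01.
have -> : xsqr x = xsum x.
  by apply: eq_bigr => i _; case: (x01 i) => ->; rewrite ?expr1n ?expr0n.
have r1 : 1 <= r by rewrite (ler_nat _ 1); lia.
have : xsum x ^+ 2 - xsum x <= r ^+ 2 - r.
  (* This product is the difference of the two sides; the second factor needs [1 <= r]. *)
  have : 0 <= (r - xsum x) * (r + xsum x - 1) by apply: mulr_ge0; lra.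
  lra.
have : (2 * sigma - 1) * xpair x <= (2 * sigma - 1) * (2 * u).
  by rewrite ler_wpM2l //; lra.
lra.
Qed.

End PairedPolytope.

(** * The lower bound on the gap *)

(** Let [m] be the minimum. From [m * r <= sigma] and [m * (2 * u) <= r], the two terms bounding
    [m * b] are at most [sigma * r / 2] and [sigma * r], while [a] is at least [sigma * r / 2];
    hence the factor 1/3. *)
Lemma gap_estimate (R : realType) (sigma r u a b : R) :
  1 <= sigma -> 0 <= u -> 1 <= r ->
  a = 2^-1 * (r ^+ 2 + (sigma - 1) * (r + 2 * u)) ->
  b = 2^-1 * (r * (r - 1)) + (2 * sigma - 1) * u ->
  (3^-1%:E * Order.min (r%:E / (2 * u)%:E) (sigma%:E / r%:E)
    <= a%:E / b%:E)%E.
Proof.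
move=> s1 u0 r1 aE bE.
have a_ge : 2^-1 * (sigma * r) <= a by rewrite aE; nra.
have b_le : b <= 2^-1 * r ^+ 2 + 2 * sigma * u by rewrite bE; nra.
have b_ge0 : 0 <= b by rewrite bE; nra.
have sr0 : 0 < sigma * r by nra.
(* [b] vanishes only for [r = 1] and [u = 0]; as [a] is positive, the quotient is then [+oo]. *)
have [b0|bN0] := eqVneq b 0.
  by rewrite b0 inve0 gt0_muley ?leey // lte_fin; lra.
have b_gt0 : 0 < b by rewrite lt_neqAle eq_sym bN0.
have [m [-> m0 m_u m_r]] : exists m : R,
    [/\ Order.min (r%:E / (2 * u)%:E)%E (sigma%:E / r%:E)%E = m%:E, 0 <= m,
        m * (2 * u) <= r & m * r <= sigma].
  have rE : (sigma%:E / r%:E)%E = (sigma / r)%:E.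
    by rewrite inver gt_eqF //; lra.
  have sr_ge0 : 0 <= sigma / r by rewrite divr_ge0 //; lra.
  have sr_r : sigma / r * r = sigma by rewrite divfK // gt_eqF //; lra.
  (* For [u = 0], that is [c = 2], the first ratio is [+oo] and the minimum is the finite
     [sigma / r]. *)
  rewrite rE; have [->|uN0] := eqVneq u 0.
    exists (sigma / r); rewrite mulr0 inve0 gt0_muley ?lte_fin; last lra.
    by split=> //; [rewrite mulr0; lra|rewrite sr_r].
  have u2 : 0 < 2 * u by rewrite mulr_gt0 // lt_neqAle eq_sym uN0.
  exists (Num.min (r / (2 * u)) (sigma / r)); split.
  - by rewrite inver gt_eqF // EFin_min.
  - by rewrite le_min sr_ge0 andbT divr_ge0 //; lra.
  - by rewrite -ler_pdivlMr // ge_min lexx.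
  - by rewrite -ler_pdivlMr ?ge_min ?lexx ?orbT //; lra.
rewrite inver (negbTE bN0) -!EFinM lee_fin ler_pdivlMr //.
apply: le_trans a_ge.
have : m * b <= m * (2^-1 * r ^+ 2 + 2 * sigma * u) by exact: ler_wpM2l.
have : m * r * r <= sigma * r by rewrite ler_wpM2r //; lra.
have : sigma * (m * (2 * u)) <= sigma * r by rewrite ler_wpM2l //; lra.
lra.
Qed.

Theorem theorem8 (R : realType) :
  exists2 K : R, 0 < K &
    forall (sigma : R) (k t : nat), 1 <= sigma -> (1 <= t <= k)%N ->
      let r := (k + t - 1)%N in
      let c := (2 * t)%N in
      exists (f : {set 'I_(2 * k)} -> R) (M : matroid 'I_(2 * k)) (g : \bar R),
        [/\ semi_metric_diversity sigma f,
            mrank M = r,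
            min_circuit_size M c,
            integrality_gap (multilinear_ext f) (matroid_polytope R M) g
          & (K%:E * Order.min (r%:R%:E / (c%:R - 2)%:E) (sigma%:E / r%:R%:E)
             <= g)%E].
Proof.
exists 3^-1; first by rewrite invr_gt0.
move=> sigma k t s1 /andP[t_gt0 t_lek] r c.
have rE : r = (k + t.-1)%N by rewrite /r; lia.
have cE : c%:R - 2 = 2 * t.-1%:R :> R.
  by rewrite /c -(prednK t_gt0) natrM -natr1 /=; ring.
pose a : R := 2^-1 * (r%:R ^+ 2 + (sigma - 1) * (r%:R + 2 * t.-1%:R)).
pose b : R := 2^-1 * (r%:R * (r%:R - 1)) + (2 * sigma - 1) * t.-1%:R.
exists (diversity (paired_mx k sigma)), (paired_matroid k t_gt0).
exists (a%:E / b%:E)%E; split.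
- by exists (paired_mx k sigma) => //; exact: semi_metric_paired_mx.
- by rewrite rE; exact: mrank_paired_matroid.
- exact: min_circuit_size_paired_matroid.
- exists a, b; rewrite /a /b rE.
  by split=> //; [exact: is_maximum_frac|exact: is_maximum_integral].
- rewrite cE; apply: (@gap_estimate _ _ _ t.-1%:R) => //.
  by rewrite (ler_nat _ 1) rE; lia.
Qed.
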